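(* Let $A$ be a finite alphabet, $0\le k\le n$ integers, and $a_1,\ldots,a_n\in A$. Then $$a_1\cdots a_k\sqcup\!\sqcup_q a_{k+1}\cdots a_n=\sum_{\substack{\pi\in S_n:\ \pi(1)<\cdots<\pi(k),\\ \pi(k+1)<\cdots<\pi(n)}} q^{\operatorname{inv}(\pi)}\,a_{\pi^{-1}(1)}\cdots a_{\pi^{-1}(n)},$$ and in particular the $q$-shuffle $\sqcup\!\sqcup_q$ is associative.
   Context: $A^*$ is the free monoid of finite words over $A$ (with concatenation and empty word $\varepsilon$), and $|w|$ is the length of a word $w$. $\mathbb{N}[q]\langle A^*\rangle$ is the set of finite formal sums of words with coefficients in $\mathbb{N}[q]$; for $s\in\mathbb{N}[q]\langle A^*\rangle$ and a letter $a$, $sa$ denotes the polynomial obtained by appending $a$ to each word of $s$. The $q$-shuffle $u\sqcup\!\sqcup_q v\in\mathbb{N}[q]\langle A^*\rangle$ of two words is defined recursively by $u\sqcup\!\sqcup_q\varepsilon=\varepsilon\sqcup\!\sqcup_q u=u$ and, for $u,v\in A^*$, $a,b\in A$, $$ua\sqcup\!\sqcup_q vb=q^{|vb|}(u\sqcup\!\sqcup_q vb)a+(ua\sqcup\!\sqcup_q v)b,$$ and it is extended bilinearly to $\mathbb{N}[q]\langle A^*\rangle$. $S_n$ is the symmetric group on $\{1,\ldots,n\}$ and $\operatorname{inv}(\pi)=\#\{1\le i<j\le n:\pi(i)>\pi(j)\}$.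
   Formalization: The recursion is corrected to ua ⧢_q vb = q^{|vb|}(u ⧢_q vb)a + (ua ⧢_q v)b; as printed, with (u ⧢_q v)a in the first term, it gives a ⧢_q b = qa + ab, whereas the claimed formula gives ab + q ba. *)

(* Defs.v *)
From HB Require Import structures.
From mathcomp Require Import all_boot all_order all_algebra all_fingroup.
From mathcomp Require Import finmap.

Set Implicit Arguments.
Unset Strict Implicit.
Unset Printing Implicit Defensive.

Import GRing.Theory.
Local Open Scope ring_scope.

(* N[q]<A^*>: finitely supported functions from words to N[q] = {poly nat},
   with q = 'X.  The monoid algebras of multinomials require coefficients in a
   zmodType, which {poly nat} is not. *)
Definition wpoly (A : finType) : Type := {fsfun seq A -> {poly nat} with 0}.

Section WPoly.
Variable A : finType.
Implicit Types (s t : wpoly A) (c : {poly nat}) (u v w : seq A) (a b : A).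

HB.instance Definition _ :=
  Choice.copy (wpoly A) {fsfun seq A -> {poly nat} with 0}.

Definition wcoef s w : {poly nat} := fun_of_fsfun s w.
Definition wsupp s : seq (seq A) := enum_fset (finsupp s).

Lemma wpolyP s t : (forall w, wcoef s w = wcoef t w) <-> s = t.
Proof. by split=> [h|->//]; apply/fsfunP/h. Qed.

Lemma mem_wsupp s w : (w \in wsupp s) = (wcoef s w != 0).
Proof. by rewrite /wsupp /wcoef -mem_finsupp. Qed.

Lemma wcoef_notin s w : w \notin wsupp s -> wcoef s w = 0.
Proof. by rewrite mem_wsupp negbK => /eqP. Qed.

Definition wzero : wpoly A := [fsfun].
Definition wadd s t : wpoly A :=
  [fsfun w in (finsupp s `|` finsupp t)%fset => wcoef s w + wcoef t w].
Definition wscale c s : wpoly A := [fsfun w in finsupp s => c * wcoef s w].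
Definition word w : wpoly A := [fsfun x in [fset w]%fset => 1].

Lemma wzeroE w : wcoef wzero w = 0.
Proof. by rewrite /wcoef fsfun0E. Qed.

Lemma waddE s t w : wcoef (wadd s t) w = wcoef s w + wcoef t w.
Proof.
rewrite {1}/wcoef fsfun_fun in_fsetU; case: ifP => // /negbT.
by rewrite negb_or => /andP[? ?]; rewrite !wcoef_notin ?addr0.
Qed.

Lemma wscaleE c s w : wcoef (wscale c s) w = c * wcoef s w.
Proof.
rewrite {1}/wcoef fsfun_fun; case: ifP => // /negbT ?.
by rewrite wcoef_notin ?mulr0.
Qed.

Lemma wordE w x : wcoef (word w) x = (x == w)%:R.
Proof. by rewrite /wcoef fsfun_fun in_fset1; case: eqP. Qed.

Lemma waddA : associative wadd.
Proof. by move=> s t r; apply/wpolyP=> w; rewrite !waddE addrA. Qed.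
Lemma waddC : commutative wadd.
Proof. by move=> s t; apply/wpolyP=> w; rewrite !waddE addrC. Qed.
Lemma wadd0 : left_id wzero wadd.
Proof. by move=> s; apply/wpolyP=> w; rewrite waddE wzeroE add0r. Qed.

HB.instance Definition _ := GRing.isNmodule.Build (wpoly A) waddA waddC wadd0.

Lemma wcoefD s t w : wcoef (s + t) w = wcoef s w + wcoef t w.
Proof. exact: waddE. Qed.

Lemma wscaleA c d s : wscale c (wscale d s) = wscale (c * d) s.
Proof. by apply/wpolyP=> w; rewrite !wscaleE mulrA. Qed.
Lemma wscale0 s : wscale 0 s = 0.
Proof. by apply/wpolyP=> w; rewrite wscaleE wzeroE mul0r. Qed.
Lemma wscale1 : left_id 1 wscale.
Proof. by move=> s; apply/wpolyP=> w; rewrite wscaleE mul1r. Qed.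
Lemma wscaleDr : right_distributive wscale +%R.
Proof.
by move=> c s t; apply/wpolyP=> w; rewrite wcoefD !wscaleE wcoefD mulrDr.
Qed.
Lemma wscaleDl s : {morph wscale^~ s : c d / c + d}.
Proof. by move=> c d; apply/wpolyP=> w; rewrite wcoefD !wscaleE mulrDl. Qed.

HB.instance Definition _ := GRing.Nmodule_isLSemiModule.Build {poly nat}
  (wpoly A) wscaleA wscale0 wscale1 wscaleDr wscaleDl.

Lemma wcoefZ c s w : wcoef (c *: s) w = c * wcoef s w.
Proof. exact: wscaleE. Qed.

(* The polynomial s a. *)
Definition wrcons s a : wpoly A :=
  \sum_(w <- wsupp s) wcoef s w *: word (rcons w a).

(* The recursion removes last letters, so it is structural on the reversed
   words; qshuffle_word0l, qshuffle_word0r and qshuffle_word_rcons below are the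
   defining equations in terms of the words themselves. *)
Fixpoint qshuffle_rev (u : seq A) : seq A -> wpoly A :=
  if u is a :: u' then
    fix qsh_u (v : seq A) : wpoly A :=
      if v is b :: v' then
        'X^(size v) *: wrcons (qshuffle_rev u' v) a + wrcons (qsh_u v') b
      else word (rev u)
  else fun v => word (rev v).

Definition qshuffle_word u v : wpoly A := qshuffle_rev (rev u) (rev v).

Lemma qshuffle_word0l v : qshuffle_word [::] v = word v.
Proof. by rewrite /qshuffle_word /= revK. Qed.

Lemma qshuffle_word0r u : qshuffle_word u [::] = word u.
Proof.
by rewrite /qshuffle_word -[in RHS](revK u); case: (rev u).
Qed.

Lemma qshuffle_word_rcons u v a b :
  qshuffle_word (rcons u a) (rcons v b) =
    'X^(size (rcons v b)) *: wrcons (qshuffle_word u (rcons v b)) a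
    + wrcons (qshuffle_word (rcons u a) v) b.
Proof. by rewrite /qshuffle_word !rev_rcons /= size_rev size_rcons. Qed.

Definition qshuffle s t : wpoly A :=
  \sum_(u <- wsupp s) \sum_(v <- wsupp t)
    (wcoef s u * wcoef t v) *: qshuffle_word u v.

Lemma wsupp_word w : wsupp (word w) = [:: w].
Proof.
apply: perm_small_eq => //; apply: uniq_perm => //; first exact: fset_uniq.
move=> x; rewrite mem_wsupp wordE inE.
by case: (x == w); rewrite ?oner_eq0 ?eqxx.
Qed.

Lemma wrcons_word w a : wrcons (word w) a = word (rcons w a).
Proof. by rewrite /wrcons wsupp_word big_seq1 wordE eqxx scale1r. Qed.

Lemma qshuffle_wordE u v : qshuffle (word u) (word v) = qshuffle_word u v.
Proof.
by rewrite /qshuffle !wsupp_word !big_seq1 !wordE !eqxx mulr1 scale1r.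
Qed.

End WPoly.

Definition inversions n (pi : 'S_n) : nat :=
  #|[set p : 'I_n * 'I_n | (p.1 < p.2)%N && (pi p.2 < pi p.1)%N]|.

(* pi(1) < ... < pi(k) and pi(k+1) < ... < pi(n), with indices shifted to
   0, ..., n-1. *)
Definition shuffle_perm n (k : nat) (pi : 'S_n) : bool :=
  [forall i : 'I_n, forall j : 'I_n, (i < j < k)%N ==> (pi i < pi j)%N] &&
  [forall i : 'I_n, forall j : 'I_n, (k <= i < j)%N ==> (pi i < pi j)%N].

(* Main.v *)
(* On words, the q-shuffle recursion splits according to which last letter comes
   last in the result.  On the side of S_{n+1} this is the position i of the
   maximal value of pi, which for a shuffle permutation is the last index of one
   of the two blocks; deleting it leaves a shuffle permutation of S_n and removes
   n - i inversions (i counted from 0), that is |vb| when i is the index of a and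
   none when it is that of b.

   For associativity, let D be the linear map w |-> q^|w| w.  Then
     (s a) * (t b) = (s * D(t b)) a + ((s a) * t) b
   for all polynomials s, t, and D is multiplicative for the q-shuffle, so both
   bracketings of (u a) * (v b) * (w c) expand into the same three terms. *)
Require Import Defs.
From mathcomp Require Import all_boot all_algebra all_fingroup finmap zify.

Set Implicit Arguments.
Unset Strict Implicit.
Unset Printing Implicit Defensive.

Import GRing.Theory.
Local Open Scope ring_scope.

(** * Linear extension of maps defined on words *)

Section LinearExtension.
Variable A : finType.
Implicit Types (s t : wpoly A) (c : {poly nat}) (u v w : seq A) (a b : A).
Implicit Types (f : seq A -> wpoly A).

(** Common form of [wrcons], [wdeg] and each argument of [qshuffle], so that linearity is proved
    only once. *)
Definition wlin f s : wpoly A := \sum_(w <- wsupp s) wcoef s w *: f w.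

(** Words outside the support contribute zero. This lets polynomials with different supports be
    summed over one common list. *)
Lemma wlin_supset f s (r : seq (seq A)) :
  uniq r -> {subset wsupp s <= r} -> wlin f s = \sum_(w <- r) wcoef s w *: f w.
Proof.
move=> r_uniq sub_r; rewrite (bigID (mem (wsupp s))) /= addrC big1 ?add0r.
  rewrite -big_filter; apply: perm_big; apply: uniq_perm.
  - exact: fset_uniq.
  - exact: filter_uniq.
  move=> w; rewrite mem_filter; apply/idP/andP=> [ws | []] //.
  by split; last exact: sub_r.
by move=> w ws; rewrite wcoef_notin ?scale0r.
Qed.

Lemma wlinD f s t : wlin f (s + t) = wlin f s + wlin f t.
Proof.
set r := undup (wsupp s ++ wsupp t).
have sub_s : {subset wsupp s <= r} by move=> w; rewrite mem_undup mem_cat => ->.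
have sub_t : {subset wsupp t <= r}.
  by move=> w; rewrite mem_undup mem_cat orbC => ->.
have sub_st : {subset wsupp (s + t) <= r}.
  move=> w; apply: contraLR => w_r; rewrite mem_wsupp negbK wcoefD.
  rewrite !wcoef_notin ?addr0 //.
    by apply: contra w_r; apply: sub_t.
  by apply: contra w_r; apply: sub_s.
have r_uniq : uniq r := undup_uniq _.
rewrite (wlin_supset f r_uniq sub_s) (wlin_supset f r_uniq sub_t).
rewrite (wlin_supset f r_uniq sub_st) -big_split /=.
by apply: eq_bigr => w _; rewrite wcoefD scalerDl.
Qed.

Lemma wlinZ f c s : wlin f (c *: s) = c *: wlin f s.
Proof.
have sub_cs : {subset wsupp (c *: s) <= wsupp s}.
  move=> w; apply: contraLR => ws; rewrite mem_wsupp negbK wcoefZ.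
  by rewrite wcoef_notin ?mulr0.
rewrite (wlin_supset f (fset_uniq _) sub_cs) scaler_sumr.
by apply: eq_bigr => w _; rewrite wcoefZ scalerA.
Qed.

Lemma wlin0 f : wlin f 0 = 0.
Proof. by rewrite -[in LHS](scale0r 0) wlinZ scale0r. Qed.

Lemma wlin_sum f I (r : seq I) (P : pred I) (F : I -> wpoly A) :
  wlin f (\sum_(i <- r | P i) F i) = \sum_(i <- r | P i) wlin f (F i).
Proof. exact: (big_morph _ (wlinD f) (wlin0 f)). Qed.

Lemma wlin_word f w : wlin f (word w) = f w.
Proof. by rewrite /wlin wsupp_word big_seq1 wordE eqxx scale1r. Qed.

Lemma wpoly_sum_word s : s = \sum_(w <- wsupp s) wcoef s w *: word w.
Proof.
apply/wpolyP => w.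
rewrite (big_morph (fun s => wcoef s w) (fun s t => wcoefD s t w) (wzeroE w)).
have [ws | ws] := boolP (w \in wsupp s).
  rewrite (bigD1_seq w) ?fset_uniq //= wcoefZ wordE eqxx mulr1.
  rewrite big1 ?addr0 // => x /negPf xw.
  by rewrite wcoefZ wordE eq_sym xw mulr0.
rewrite wcoef_notin // big_seq big1 // => x xs.
rewrite wcoefZ wordE; case: eqP => [wx | _]; last by rewrite mulr0.
by rewrite wx xs in ws.
Qed.

(** Words span [wpoly A]; hence an identity linear in a polynomial need only be checked on words. *)
Lemma wpoly_ind (P : wpoly A -> Prop) :
    P 0 -> (forall s t, P s -> P t -> P (s + t)) ->
    (forall c s, P s -> P (c *: s)) -> (forall w, P (word w)) ->
  forall s, P s.
Proof.
move=> P0 PD PZ Pw s; rewrite (wpoly_sum_word s).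
by apply: big_ind => // w _; apply: PZ.
Qed.

End LinearExtension.

(** * Bilinearity and associativity of the q-shuffle *)

Section QShuffleAlgebra.
Variable A : finType.
Implicit Types (s t : wpoly A) (c : {poly nat}) (u v w : seq A) (a b : A).

Lemma wrconsD s t a : wrcons (s + t) a = wrcons s a + wrcons t a.
Proof. exact: wlinD. Qed.

Lemma wrconsZ c s a : wrcons (c *: s) a = c *: wrcons s a.
Proof. exact: wlinZ. Qed.

Lemma wrcons0 a : wrcons 0 a = 0.
Proof. exact: wlin0. Qed.

Lemma wrcons_sum a I (r : seq I) (P : pred I) (F : I -> wpoly A) :
  wrcons (\sum_(i <- r | P i) F i) a = \sum_(i <- r | P i) wrcons (F i) a.
Proof. exact: wlin_sum. Qed.

Lemma qshuffle_wlin s t :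
  qshuffle s t = wlin (fun u => wlin (qshuffle_word u) t) s.
Proof.
rewrite /qshuffle /wlin; apply: eq_bigr => u _; rewrite scaler_sumr.
by apply: eq_bigr => v _; rewrite scalerA.
Qed.

Lemma qshuffleDl s1 s2 t : qshuffle (s1 + s2) t = qshuffle s1 t + qshuffle s2 t.
Proof. by rewrite !qshuffle_wlin wlinD. Qed.

Lemma qshuffleZl c s t : qshuffle (c *: s) t = c *: qshuffle s t.
Proof. by rewrite !qshuffle_wlin wlinZ. Qed.

Lemma qshuffle0l t : qshuffle 0 t = 0.
Proof. by rewrite qshuffle_wlin wlin0. Qed.

Lemma qshuffleDr s t1 t2 : qshuffle s (t1 + t2) = qshuffle s t1 + qshuffle s t2.
Proof.
rewrite !qshuffle_wlin /wlin -big_split; apply: eq_bigr => u _ /=.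
by rewrite -scalerDr; congr (_ *: _); apply: wlinD.
Qed.

Lemma qshuffleZr c s t : qshuffle s (c *: t) = c *: qshuffle s t.
Proof.
rewrite !qshuffle_wlin /wlin scaler_sumr; apply: eq_bigr => u _ /=.
by rewrite scalerA mulrC -scalerA; congr (_ *: _); apply: wlinZ.
Qed.

Lemma qshuffle0r s : qshuffle s 0 = 0.
Proof. by rewrite -[in LHS](scale0r 0) qshuffleZr scale0r. Qed.

Lemma qshuffle1l t : qshuffle (word [::]) t = t.
Proof.
elim/wpoly_ind: t => [|s t IHs IHt|c s IHs|w].
- exact: qshuffle0r.
- by rewrite qshuffleDr IHs IHt.
- by rewrite qshuffleZr IHs.
- by rewrite qshuffle_wordE qshuffle_word0l.
Qed.

Lemma qshuffle1r s : qshuffle s (word [::]) = s.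
Proof.
elim/wpoly_ind: s => [|s t IHs IHt|c s IHs|w].
- exact: qshuffle0l.
- by rewrite qshuffleDl IHs IHt.
- by rewrite qshuffleZl IHs.
- by rewrite qshuffle_wordE qshuffle_word0r.
Qed.

(* Turning the length-dependent weight of the recursion into the linear operator
   w |-> q^|w| w makes the recursion bilinear. *)
Definition wdeg s : wpoly A := wlin (fun w => 'X^(size w) *: word w) s.

Lemma wdegD s t : wdeg (s + t) = wdeg s + wdeg t.
Proof. exact: wlinD. Qed.

Lemma wdegZ c s : wdeg (c *: s) = c *: wdeg s.
Proof. exact: wlinZ. Qed.

Lemma wdeg0 : wdeg 0 = 0.
Proof. exact: wlin0. Qed.

Lemma wdeg_word w : wdeg (word w) = 'X^(size w) *: word w.
Proof. exact: wlin_word. Qed.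

Lemma wdeg_wrcons s a : wdeg (wrcons s a) = 'X *: wrcons (wdeg s) a.
Proof.
elim/wpoly_ind: s => [|s t IHs IHt|c s IHs|w].
- by rewrite !(wrcons0, wdeg0, scaler0).
- by rewrite !(wrconsD, wdegD, scalerDr) IHs IHt.
- by rewrite !(wrconsZ, wdegZ) IHs !scalerA mulrC.
- by rewrite wrcons_word !wdeg_word wrconsZ wrcons_word scalerA size_rcons exprS.
Qed.

(** With [wdeg] carrying the weight, both sides are bilinear in [s] and [t]; on words this is the
    defining recursion. *)
Lemma qshuffle_wrcons s t a b :
  qshuffle (wrcons s a) (wrcons t b) =
    wrcons (qshuffle s (wdeg (wrcons t b))) a
    + wrcons (qshuffle (wrcons s a) t) b.
Proof.
elim/wpoly_ind: s => [|s s' IHs IHs'|c s IHs|u].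
- by rewrite !(wrcons0, qshuffle0l) addr0.
- by rewrite !(wrconsD, qshuffleDl) IHs IHs' addrACA.
- by rewrite !(wrconsZ, qshuffleZl) IHs scalerDr.
elim/wpoly_ind: t => [|t t' IHt IHt'|c t IHt|v].
- by rewrite !(wrcons0, wdeg0, qshuffle0r) addr0.
- by rewrite !(wrconsD, wdegD, qshuffleDr) IHt IHt' addrACA.
- by rewrite !(wrconsZ, wdegZ, qshuffleZr) IHt scalerDr.
rewrite !wrcons_word wdeg_word qshuffleZr wrconsZ !qshuffle_wordE.
exact: qshuffle_word_rcons.
Qed.

(** Every word of the q-shuffle has length [size u + size v]. The induction is on this sum, since
    the recursion shortens either word. *)
Lemma wdeg_qshuffle_word u v :
  wdeg (qshuffle_word u v) = 'X^(size u + size v) *: qshuffle_word u v.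
Proof.
have [n] := ubnP (size u + size v); elim: n u v => // n IHn.
elim/last_ind=> [|u a _] v; first by rewrite qshuffle_word0l wdeg_word.
case/lastP: v => [|v b]; first by rewrite qshuffle_word0r wdeg_word addn0.
rewrite !size_rcons addSn ltnS => lt_n.
rewrite qshuffle_word_rcons wdegD wdegZ !wdeg_wrcons.
rewrite !IHn ?size_rcons //; last by rewrite addSnnS.
rewrite !wrconsZ scalerDr !scalerA !(addSn, addnS) !exprS.
by congr (_ *: _ + _); rewrite [RHS]mulrC !mulrA.
Qed.

Lemma wdeg_qshuffle s t : wdeg (qshuffle s t) = qshuffle (wdeg s) (wdeg t).
Proof.
elim/wpoly_ind: s => [|s s' IHs IHs'|c s IHs|u].
- by rewrite !(wdeg0, qshuffle0l).
- by rewrite !(wdegD, qshuffleDl) IHs IHs'.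
- by rewrite !(wdegZ, qshuffleZl) IHs.
elim/wpoly_ind: t => [|t t' IHt IHt'|c t IHt|v].
- by rewrite !(wdeg0, qshuffle0r).
- by rewrite !(wdegD, qshuffleDr) IHt IHt'.
- by rewrite !(wdegZ, qshuffleZr) IHt.
rewrite !wdeg_word qshuffleZl qshuffleZr qshuffle_wordE wdeg_qshuffle_word.
by rewrite scalerA exprD.
Qed.

Lemma qshuffle_wordA u v w :
  qshuffle (word u) (qshuffle (word v) (word w)) =
    qshuffle (qshuffle (word u) (word v)) (word w).
Proof.
have [n] := ubnP (size u + size v + size w); elim: n u v w => // n IHn.
elim/last_ind=> [|u a _] v w; first by rewrite !qshuffle1l.
case/lastP: v => [|v b]; first by rewrite qshuffle1l qshuffle1r.
case/lastP: w => [|w c]; first by rewrite !qshuffle1r.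
rewrite !size_rcons !(addSn, addnS) !ltnS => lt_n.
have IHu := IHn u (rcons v b) (rcons w c).
have IHv := IHn (rcons u a) v (rcons w c).
have IHw := IHn (rcons u a) (rcons v b) w.
rewrite !size_rcons !(addSn, addnS) -!wrcons_word in IHu IHv IHw.
rewrite -!wrcons_word [in LHS](qshuffle_wrcons (word v)).
rewrite [qshuffle (wrcons (word u) a) (wrcons (word v) b)]qshuffle_wrcons.
rewrite qshuffleDr qshuffleDl !qshuffle_wrcons.
(* On the left, the two terms ending in [a] recombine by the recursion read backwards, under [wdeg],
   for the product of [v b] and [w c]. *)
rewrite [LHS]addrACA -wrconsD -qshuffleDr -wdegD -qshuffle_wrcons.
(* On the right, the two terms ending in [c] recombine likewise. Three terms remain on each side,
   ending in [a], [b] and [c]. *)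
rewrite [RHS]addrACA -[X in _ = _ + X]wrconsD -qshuffleDl -qshuffle_wrcons.
rewrite -IHw // addrA wdeg_qshuffle.
have -> : qshuffle (word u)
    (qshuffle (wdeg (wrcons (word v) b)) (wdeg (wrcons (word w) c))) =
  qshuffle (qshuffle (word u) (wdeg (wrcons (word v) b)))
    (wdeg (wrcons (word w) c)).
  (* On a single word [wdeg] is a scalar, which is pulled out to expose the induction hypothesis. *)
  rewrite !wrcons_word !wdeg_word !(qshuffleZl, qshuffleZr) -!wrcons_word.
  by rewrite IHu // !scalerA mulrC.
have -> // : qshuffle (wrcons (word u) a)
    (qshuffle (word v) (wdeg (wrcons (word w) c))) =
  qshuffle (qshuffle (wrcons (word u) a) (word v)) (wdeg (wrcons (word w) c)).
by rewrite [wrcons (word w) c]wrcons_word wdeg_word !qshuffleZr -wrcons_word IHv.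
Qed.

Lemma qshuffleA : associative (@qshuffle A).
Proof.
move=> s t r; elim/wpoly_ind: s => [|s s' IHs IHs'|c s IHs|u].
- by rewrite !qshuffle0l.
- by rewrite !qshuffleDl IHs IHs'.
- by rewrite !qshuffleZl IHs.
elim/wpoly_ind: t => [|t t' IHt IHt'|c t IHt|v].
- by rewrite !(qshuffle0l, qshuffle0r).
- by rewrite !(qshuffleDl, qshuffleDr) IHt IHt'.
- by rewrite !(qshuffleZl, qshuffleZr) IHt.
elim/wpoly_ind: r => [|r r' IHr IHr'|c r IHr|w].
- by rewrite !qshuffle0r.
- by rewrite !qshuffleDr IHr IHr'.
- by rewrite !qshuffleZr IHr.
exact: qshuffle_wordA.
Qed.

End QShuffleAlgebra.

(** * Deleting the maximal value of a permutation *)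

Section LiftPerm.

(** [lift_perm i j] is a bijection from ['S_n] onto the permutations sending [i] to [j]. *)
Lemma reindex_lift_perm (M : nmodType) n (i j : 'I_n.+1) (P : pred 'S_n.+1)
    (F : 'S_n.+1 -> M) :
  \sum_(s | P s && (s i == j)) F s =
    \sum_(s : 'S_n | P (lift_perm i j s)) F (lift_perm i j s).
Proof.
rewrite (reindex (lift_perm i j)) /=.
  by apply: eq_bigl => s; rewrite lift_perm_id eqxx andbT.
have lift_perm_inj : injective (@lift_perm n i j).
  move=> s t st; apply/permP => k; apply: (@lift_inj _ j).
  by rewrite -!(lift_perm_lift i) st.
(* The default [1%g] is reached only when [s] does not send [i] to [j]. *)
exists (fun s => odflt 1%g [pick t | lift_perm i j t == s]) => s.
  by case: pickP => [t /eqP/lift_perm_inj | /(_ s)]; rewrite ?eqxx.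
rewrite inE => /andP[_ /eqP si_j]; case: pickP => [t /eqP // | no_t].
(* [f] is [s] with the point [i] and its value [j] deleted. *)
have /fin_all_exists[f fE] k : exists l, lift j l = s (lift i k).
  case: (unliftP j (s (lift i k))) => [l -> | sl_j]; first by exists l.
  have /perm_inj i_lift : s i = s (lift i k) by rewrite si_j sl_j.
  by have := neq_lift i k; rewrite -i_lift eqxx.
have f_inj : injective f.
  by move=> k l kl; apply/(@lift_inj _ i)/(@perm_inj _ s); rewrite -!fE kl.
case/eqP: (no_t (perm f_inj)); apply/permP => k.
case: (unliftP i k) => [l|] ->; last by rewrite lift_perm_id.
by rewrite lift_perm_lift permE fE.
Qed.

Lemma lt_lift n (h : 'I_n.+1) (i j : 'I_n) : (lift h i < lift h j)%N = (i < j)%N.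
Proof. by rewrite !ltnNge /= leq_bump2. Qed.

Lemma inversionsE n (pi : 'S_n) :
  inversions pi = (\sum_(i < n) \sum_(j < n) ((i < j) && (pi j < pi i)))%N.
Proof.
rewrite /inversions -sum1_card pair_big /= big_mkcond /=.
by apply: eq_bigr => p _; rewrite inE; case: ifP.
Qed.

Lemma sum_leq_ord n i : (\sum_(j < n) (i <= j) = n - i)%N.
Proof.
elim: n => [|n IHn]; first by rewrite big_ord0.
rewrite big_ord_recr /= IHn; case: leqP => [/subSn-> | lt_ni].
  by rewrite addn1.
by rewrite addn0; apply/eqP; rewrite (eqP (ltnW lt_ni)) eq_sym subn_eq0.
Qed.

(** The maximal value, at position [i], is inverted with exactly the [n - i] later positions; [lift]
    preserves the order of all other pairs. *)
Lemma inversions_lift_max n (i : 'I_n.+1) (s : 'S_n) :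
  inversions (lift_perm i ord_max s) = (n - i + inversions s)%N.
Proof.
rewrite !inversionsE (bigD1_ord i) //=; congr (_ + _)%N.
  rewrite (bigD1_ord i) //= ltnn add0n -sum_leq_ord; apply: eq_bigr => j _.
  rewrite lift_perm_id lift_perm_lift lift_max ltn_ord andbT leq_bump.
  by rewrite /unbump ltnSn subn1.
apply: eq_bigr => j _; rewrite (bigD1_ord i) //= lift_perm_id.
rewrite (ltnNge (@ord_max n)) leq_ord andbF add0n; apply: eq_bigr => k _.
by rewrite !lift_perm_lift !lt_lift.
Qed.

Lemma shuffle_permP n k (pi : 'S_n) :
  reflect ((forall i j : 'I_n, i < j < k -> pi i < pi j) /\
           (forall i j : 'I_n, k <= i < j -> pi i < pi j))%N
    (shuffle_perm k pi).
Proof.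
by apply: (iffP andP) => -[l r]; split;
  [move=> i j; move/forallP/(_ i)/forallP/(_ j)/implyP: l
  |move=> i j; move/forallP/(_ i)/forallP/(_ j)/implyP: r
  |apply/forallP => i; apply/forallP => j; apply/implyP/l
  |apply/forallP => i; apply/forallP => j; apply/implyP/r].
Qed.

(* [hi] says that i is the last index of its block, so that placing the maximal
   value there preserves monotonicity. *)
Lemma shuffle_perm_lift n k k' (i : 'I_n.+1) (s : 'S_n) :
    (forall j, (lift i j < k) = (j < k'))%N ->
    (forall j, i < lift i j -> i < k <= lift i j)%N ->
  shuffle_perm k (lift_perm i ord_max s) = shuffle_perm k' s.
Proof.
move=> hk hi; have hk' j : (k <= lift i j)%N = (k' <= j)%N.
  by rewrite leqNgt hk -leqNgt.
apply/shuffle_permP/shuffle_permP => -[l r]; split => x y.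
- by have := l (lift i x) (lift i y); rewrite !lift_perm_lift !lt_lift hk.
- by have := r (lift i x) (lift i y); rewrite !lift_perm_lift !lt_lift hk'.
- case: (unliftP i x) (unliftP i y) => [x'|] -> [y'|] ->.
  + by rewrite !lift_perm_lift !lt_lift hk; apply: l.
  + by rewrite lift_perm_lift lift_perm_id lift_max ltn_ord.
  + by case/andP=> /hi/andP[_]; rewrite leqNgt => /negPf->.
  + by rewrite ltnn.
case: (unliftP i x) (unliftP i y) => [x'|] -> [y'|] ->.
- by rewrite !lift_perm_lift !lt_lift hk'; apply: r.
- by rewrite lift_perm_lift lift_perm_id lift_max ltn_ord.
- by case/andP=> ki /hi/andP[]; rewrite ltnNge ki.
- by rewrite ltnn andbF.
Qed.

(** Otherwise [i.+1] would lie in the same block as [i] and have a value above the maximum. *)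
Lemma shuffle_perm_max n k (pi : 'S_n.+1) (i : 'I_n.+1) :
  shuffle_perm k pi -> pi i = ord_max -> i = ord_max \/ i.+1 = k.
Proof.
move=> /shuffle_permP[l r] pi_i.
have [lt_in | le_ni] := ltnP i n; last first.
  by left; apply/val_inj/anti_leq; rewrite leq_ord.
have lt_iSn : (i.+1 < n.+1)%N by [].
have nlt (j : 'I_n.+1) : ~ (pi i < pi j)%N by rewrite pi_i ltnNge leq_ord.
right; case: (ltngtP i.+1 k) => // [lt_k | ]; last rewrite ltnS => le_k.
  by case: (nlt (Ordinal lt_iSn)); apply: l; rewrite /= ltnSn.
by case: (nlt (Ordinal lt_iSn)); apply: r; rewrite /= le_k ltnSn.
Qed.

Lemma map_lift_permV (T : Type) n (f : 'I_n.+1 -> T) i (s : 'S_n) :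
  [seq f (((lift_perm i ord_max s)^-1)%g j) | j <- enum 'I_n.+1] =
    rcons [seq f (lift i ((s^-1)%g j)) | j <- enum 'I_n] (f i).
Proof.
rewrite lift_permV enum_ordSr map_rcons lift_perm_id -map_comp.
congr rcons; apply: eq_map => j /=.
have -> : widen_ord (leqnSn n) j = lift ord_max j.
  by apply: ord_inj; rewrite lift_max.
by rewrite lift_perm_lift.
Qed.

End LiftPerm.

(** * The sum over shuffle permutations and its recursion *)

Section ShuffleSum.
Variable A : finType.

(** The letters form a function on indices, so that deleting index [i] is composition with
    [lift i]. *)
Definition shuffle_sum n k (f : 'I_n -> A) : wpoly A :=
  \sum_(pi : 'S_n | shuffle_perm k pi)
     'X^(inversions pi) *: word [seq f ((pi^-1)%g i) | i <- enum 'I_n].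

Lemma shuffle_sum0 k (f : 'I_0 -> A) : shuffle_sum k f = word [::].
Proof.
rewrite /shuffle_sum (big_pred1 1%g) => [|pi].
  rewrite inversionsE big_ord0 scale1r.
  by congr word; apply: size0nil; rewrite size_map size_enum_ord.
have -> : pi = 1%g by apply/permP => -[].
by rewrite /= eqxx; apply/shuffle_permP; split => -[].
Qed.

Lemma eq_shuffle_sum n k (f g : 'I_n -> A) :
  f =1 g -> shuffle_sum k f = shuffle_sum k g.
Proof.
by move=> fg; apply: eq_bigr => pi _; congr (_ *: word _); apply: eq_map => i.
Qed.

Lemma shuffle_sum_lift n k k' (f : 'I_n.+1 -> A) (i : 'I_n.+1) :
    (forall j, (lift i j < k) = (j < k'))%N ->
    (forall j, i < lift i j -> i < k <= lift i j)%N ->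
  \sum_(pi : 'S_n.+1 | shuffle_perm k pi && (pi i == ord_max))
     'X^(inversions pi) *: word [seq f ((pi^-1)%g i) | i <- enum 'I_n.+1] =
  'X^(n - i) *: wrcons (shuffle_sum k' (f \o lift i)) (f i).
Proof.
move=> hk hi; rewrite reindex_lift_perm wrcons_sum scaler_sumr.
apply: eq_big => [s | s _]; first exact: shuffle_perm_lift.
by rewrite inversions_lift_max map_lift_permV wrconsZ wrcons_word scalerA exprD.
Qed.

(** Deleting the last index costs no inversion. As [k] and [k'] need only agree on indices below
    [n], the deleted letter may belong to either block. *)
Lemma shuffle_sum_lift_max x0 n (w : seq A) b k k' :
    size w = n -> (forall j : 'I_n, (j < k) = (j < k'))%N ->
  \sum_(pi : 'S_n.+1 | shuffle_perm k pi && (pi ord_max == ord_max))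
     'X^(inversions pi) *:
       word [seq nth x0 (rcons w b) ((pi^-1)%g i) | i <- enum 'I_n.+1] =
  wrcons (shuffle_sum k' (fun i : 'I_n => nth x0 w i)) b.
Proof.
move=> szw hk.
rewrite (@shuffle_sum_lift _ _ k' (fun i => nth x0 (rcons w b) i)).
- rewrite subnn expr0 scale1r nth_rcons szw ltnn eqxx; congr wrcons.
  by apply: eq_shuffle_sum => j; rewrite /comp lift_max nth_rcons szw ltn_ord.
- by move=> j; rewrite lift_max hk.
- by move=> j; rewrite lift_max ltnNge ltnW.
Qed.

(** The last hypothesis forces one block to be empty, so the maximal value can only sit at the last
    index. *)
Lemma shuffle_sum_rcons x0 n (w : seq A) b k k' :
    size w = n -> (forall j : 'I_n, (j < k) = (j < k'))%N ->
    (forall i : 'I_n.+1, i.+1 = k -> i = ord_max) ->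
  shuffle_sum k (fun i : 'I_n.+1 => nth x0 (rcons w b) i) =
  wrcons (shuffle_sum k' (fun i : 'I_n => nth x0 w i)) b.
Proof.
move=> szw hk kmax; rewrite -(shuffle_sum_lift_max _ _ szw hk).
apply: eq_bigl => pi; case: (boolP (shuffle_perm k pi)) => //= sh_pi.
have [] := shuffle_perm_max sh_pi (permKV pi ord_max) => [|/kmax] e.
  by rewrite -{1}e permKV eqxx.
by rewrite -{1}e permKV eqxx.
Qed.

Lemma qshuffle_word_shuffle_sum x0 n (u v : seq A) : (size u + size v)%N = n ->
  qshuffle_word u v =
    shuffle_sum (size u) (fun i : 'I_n => nth x0 (u ++ v) i).
Proof.
elim: n u v => [|n IHn] u v.
  move/eqP; rewrite addn_eq0 => /andP[/nilP-> /nilP->].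
  by rewrite shuffle_sum0 qshuffle_word0l.
case/lastP: v => [|v b].
  case/lastP: u => [|u a] //; rewrite addn0 size_rcons => -[szu].
  (* The shortened word is read again as a q-shuffle with the empty word, to which the induction
     hypothesis applies. *)
  rewrite qshuffle_word0r -wrcons_word -qshuffle_word0r (IHn _ [::]) ?addn0 //.
  rewrite !cats0 szu (@shuffle_sum_rcons _ _ _ _ _ n) //.
    by move=> j; rewrite !ltnS ltnW // ltn_ord.
  by move=> i [i_n]; apply: val_inj.
case/lastP: u => [|u a].
  rewrite add0n size_rcons => -[szv].
  rewrite qshuffle_word0l -wrcons_word -qshuffle_word0l (IHn [::]) //.
  by rewrite (@shuffle_sum_rcons _ _ _ _ _ 0).
rewrite !size_rcons addSn addnS => -[szuv].
have lt_un : (size u < n.+1)%N by rewrite -szuv ltnS leqW // leq_addr.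
(* The index of the letter [a], last of the first block. *)
pose i := Ordinal lt_un.
have szw : size (rcons u a ++ v) = n by rewrite size_cat size_rcons addSn.
rewrite qshuffle_word_rcons size_rcons.
rewrite (IHn u) ?size_rcons ?addnS // (IHn (rcons u a) v) ?size_rcons ?addSn //.
(* Permutations with their maximum at [i] give the term ending in [a], the others the term ending in
   [b]. *)
rewrite [RHS]/shuffle_sum (bigID (fun pi : 'S_n.+1 => pi i == ord_max)) /=.
congr (_ + _).
  rewrite (@shuffle_sum_lift _ _ (size u)
    (fun i => nth x0 (rcons u a ++ rcons v b) i) i) /=.
  (* The inversions lost number the length of [rcons v b], the exponent in the recursion. *)
  - have -> : (n - size u = (size v).+1)%N by lia.
    rewrite cat_rcons nth_cat ltnn subnn /=.
    congr (_ *: wrcons _ _); apply: eq_shuffle_sum => j /=.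
    rewrite !nth_cat /bump; case: (leqP (size u) j) => uj /=; last by rewrite uj.
    by rewrite ltnNge add1n leqW // subSn.
  - by move=> j; rewrite /bump; case: leqP => uj; lia.
  by move=> j; rewrite /bump; case: leqP => uj; lia.
(* For shuffle permutations, not having the maximum at [i] means having it at the last index; the
   two indices differ because [rcons v b] is nonempty. *)
rewrite -[rcons u a ++ rcons v b]rcons_cat.
rewrite -(shuffle_sum_lift_max x0 b szw (fun=> erefl)).
apply: eq_bigl => pi; case: (boolP (shuffle_perm _ pi)) => //= sh_pi.
have [] := shuffle_perm_max sh_pi (permKV pi ord_max) => [|[]] e.
  have -> : pi ord_max = ord_max by rewrite -{1}e permKV.
  rewrite eqxx; apply/esym/eqP => pi_i; move: e; rewrite -{1}pi_i permK.
  by move/(congr1 val) => /=; lia.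
have {}e : (pi^-1)%g ord_max = i by apply: val_inj.
have -> : pi i = ord_max by rewrite -e permKV.
rewrite eqxx; apply/eqP => pi_max.
by move: e; rewrite -{1}pi_max permK => /(congr1 val) /=; lia.
Qed.

End ShuffleSum.

Theorem corollary5p3 (A : finType) :
  (forall (k n : nat) (a : n.-tuple A), (k <= n)%N ->
     qshuffle (word (take k a)) (word (drop k a)) =
       \sum_(pi : 'S_n | shuffle_perm k pi)
          'X^(inversions pi) *: word [seq tnth a ((pi^-1)%g i) | i <- enum 'I_n])
  /\ associative (@qshuffle A).
Proof.
split; last exact: qshuffleA.
move=> k n a le_kn; rewrite qshuffle_wordE -/(shuffle_sum k (tnth a)).
have szk : size (take k a) = k by rewrite size_takel ?size_tuple.
(* The alphabet may be empty when [n] is 0; otherwise [thead a] serves as the default letter of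
   [nth]. *)
case: n a le_kn szk => [|n] a le_kn szk.
  by rewrite tuple0 shuffle_sum0 qshuffle_word0l.
rewrite (@qshuffle_word_shuffle_sum _ (thead a) n.+1); last first.
  by rewrite -size_cat cat_take_drop size_tuple.
by rewrite szk cat_take_drop; apply: eq_shuffle_sum => i; rewrite -tnth_nth.
Qed.
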